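(* Let $a,b,s$ be positive integers with $s<\frac{(a+1)(b+1)}{2}$. If $G$ is an $a$-path-pairable graph, $H$ is a $b$-path-pairable graph, and $|V(G)|\geq 4s$ and $|V(H)|\geq 4s$, then the Cartesian product $G\square H$ is $s$-path-pairable.
   Context: Graphs are finite, simple and undirected. For a positive integer $k$, a graph $G$ on at least $2k$ vertices is called $k$-path-pairable if, for any pair of disjoint sets of pairwise different vertices $X=\{x_1,\dots,x_k\}$ and $Y=\{y_1,\dots,y_k\}$ of $G$ (so $x_1,\dots,x_k,y_1,\dots,y_k$ are $2k$ distinct vertices), there exist $k$ pairwise edge-disjoint paths $P_1,\dots,P_k$ in $G$ such that $P_i$ joins $x_i$ to $y_i$. The Cartesian product $G\square H$ has vertex set $V(G)\times V(H)$, and $(x,u)(y,v)$ is an edge if $x=y$ and $uv\in E(H)$, or $xy\in E(G)$ and $u=v$. *)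

(* Defs.v *)
From mathcomp Require Import all_boot.
Set Implicit Arguments.
Unset Strict Implicit.
Unset Printing Implicit Defensive.

Record sgraph := SGraph {
  vertex :> finType;
  adj : rel vertex;
  adj_sym : symmetric adj;
  adj_irr : irreflexive adj }.

Section CartesianProduct.
Variables G H : sgraph.

Definition cart_adj : rel (G * H)%type := fun p q =>
  ((p.1 == q.1) && adj p.2 q.2) || (adj p.1 q.1 && (p.2 == q.2)).

Lemma cart_adj_sym : symmetric cart_adj.
Proof.
move=> p q; rewrite /cart_adj [q.1 == _]eq_sym [q.2 == _]eq_sym.
by rewrite (adj_sym p.1) (adj_sym p.2).
Qed.

Lemma cart_adj_irr : irreflexive cart_adj.
Proof. by move=> p; rewrite /cart_adj !adj_irr andbF. Qed.

Definition cartesian : sgraph := SGraph cart_adj_sym cart_adj_irr.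

End CartesianProduct.

(* The path with vertex sequence x, p_0, p_1, ... is represented by its first
   vertex x and the sequence p of the remaining ones. *)
Definition joining_path (G : sgraph) (x y : G) (p : seq G) : bool :=
  [&& path (@adj G) x p, last x p == y & uniq (x :: p)].

(* Edges are the unordered pairs [set u; v] of consecutive vertices. *)
Definition path_edges (G : sgraph) (x : G) (p : seq G) : seq {set G} :=
  pairmap (fun u v => [set u; v]) x p.

Definition path_pairable (k : nat) (G : sgraph) : Prop :=
  2 * k <= #|G| /\
  forall x y : 'I_k -> G,
    injective x -> injective y -> (forall i j, x i != y j) ->
    exists P : 'I_k -> seq G,
      (forall i, joining_path (x i) (y i) (P i)) /\
      (forall i j, i != j ->
         [disjoint path_edges (x i) (P i) & path_edges (x j) (P j)]).

(* Main.v *)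
Require Import Defs.
From mathcomp Require Import all_boot.
Set Implicit Arguments.
Unset Strict Implicit.
Unset Printing Implicit Defensive.

(** Call a copy of [G] in the product a row and a copy of [H] a column.  A row
    can link any [a] disjoint pairs of its vertices and a column any [b].

    A column is overloaded when it contains more than [b] of the [2 * s]
    terminals.  Since [2 * s < (a + 1) * (b + 1)], at most [a] columns are
    overloaded ([card_large_fibres]), so every single row contains at most [a]
    terminals lying in overloaded columns.  Each row can therefore move these terminals sideways,
    each to a private column that contains no terminal at all; there are enough
    such columns because [#|G| >= 4 * s].  After this relocation no column
    carries more than [b] terminals ([card_column_load]).

    Every pair [i] now receives a private row [tau i] free of terminals, which
    exist because [#|H| >= 4 * s].  If the two terminals of the pair ended up in
    the same column, that column links them directly; otherwise their columns
    carry both of them to the row [tau i], where they are linked because [G] is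
    connected.  A column serves at most one demand per terminal it carries,
    hence at most [b] demands.  No edge is used twice: the rows of the relocation
    contain terminals and the rows [tau i] do not, and each column is used in one
    step only.

    Edge-disjointness is handled by giving every edge at most one owner (the
    predicate [routable]): systems of paths in different rows and columns then
    combine by defining the owner of an edge from the row or column containing
    it. *)

(** * Routing demands by assigning owners to edges *)

Definition owned_by (G : sgraph) (I : eqType) (own : G -> G -> option I) i :
    rel G :=
  fun u v => adj u v && (own u v == Some i).

(** Since an edge has at most one owner, connecting each demand inside the
    edges that it owns is the same as finding pairwise edge-disjoint paths.
    The symmetry of [own] makes the owner a function of the undirected edge. *)
Definition routable (G : sgraph) (I : finType) (A : {set I}) (x y : I -> G) :=
  exists own : G -> G -> option I,
    (forall u v, own u v = own v u) /\
    {in A, forall i, connect (owned_by own i) (x i) (y i)}.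

Lemma connect_homo (T U : finType) (e : rel T) (e' : rel U) (f : T -> U) :
  {homo f : u v / e u v >-> e' u v} ->
  {homo f : u v / connect e u v >-> connect e' u v}.
Proof.
move=> fE u v /connectP [p + ->]; elim: p u => [|w p IHp] u //=.
by case/andP=> /fE/connect1 uw /IHp; apply: connect_trans.
Qed.

Lemma eq_set2 (T : finType) (u v u' v' : T) :
  [set u; v] = [set u'; v'] -> (u = u' /\ v = v') \/ (u = v' /\ v = u').
Proof.
move=> E.
have: u \in [set u'; v'] by rewrite -E set21.
have: v \in [set u'; v'] by rewrite -E set22.
have: u' \in [set u; v] by rewrite E set21.
have: v' \in [set u; v] by rewrite E set22.
rewrite !inE => /orP [] /eqP-> /orP [] /eqP-> //; rewrite ?eqxx ?orbb;
  by [left|right|move=> _ /eqP->; left|move=> /eqP->; left].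
Qed.

Lemma path_edgesP (G : sgraph) (r : rel G) x p e :
  path r x p -> e \in path_edges x p ->
  exists u v, e = [set u; v] /\ r u v.
Proof.
elim: p x => [|v p IHp] x //= /andP [xv rp].
by rewrite inE => /predU1P [->|/(IHp _ rp)//]; exists x, v.
Qed.

Lemma routable_paths (G : sgraph) (I : finType) (x y : I -> G) :
  routable [set: I] x y ->
  exists P : I -> seq G,
    (forall i, joining_path (x i) (y i) (P i)) /\
    (forall i j, i != j ->
       [disjoint path_edges (x i) (P i) & path_edges (x j) (P j)]).
Proof.
case=> own [ownC link].
have /fin_all_exists [P PP] : forall i, exists p,
    path (owned_by own i) (x i) p /\ joining_path (x i) (y i) p.
  move=> i; have /connectP [p xp ->] := link i (in_setT i).
  case/shortenP: xp => q xq Uq _; exists q; split=> //.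
  rewrite /joining_path eqxx Uq !andbT.
  by apply: sub_path xq => u v /andP[].
exists P; split=> [i|i j]; first by case: (PP i).
apply: contraR => /pred0Pn [e /andP [/= ei ej]].
have [u [v [Ei /andP [_ /eqP ui]]]] := path_edgesP (PP i).1 ei.
have [u' [v' [Ej /andP [_ /eqP uj]]]] := path_edgesP (PP j).1 ej.
suff: Some i = Some j by case=> ->.
rewrite Ei in Ej; rewrite -ui -uj.
by case: (eq_set2 Ej) => [] [-> ->] //; rewrite ownC.
Qed.

(** Path-pairability speaks of exactly [k] pairs, whereas a row or a column
    receives at most [k] demands.  The [#|A|] demands are completed to [k] with
    vertices that are endpoints of no demand; since [2 * k <= #|G|], enough of
    these are left.  The paths of the added pairs own nothing. *)
Lemma path_pairable_routable k (G : sgraph) (I : finType) (A : {set I})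
    (x y : I -> G) :
  path_pairable k G -> #|A| <= k ->
  {in A &, injective x} -> {in A &, injective y} ->
  {in A &, forall i j, x i != y j} ->
  routable A x y.
Proof.
case=> cardG pairG leAk injx injy xy.
case: (set_0Vmem A) => [->|[i0 i0A]].
  by exists (fun _ _ => None); split=> // i; rewrite inE.
pose xs := [seq x i | i <- enum A]; pose ys := [seq y i | i <- enum A].
pose rest := enum [predC xs ++ ys]; pose d := k - #|A|.
pose X := xs ++ take d rest; pose Y := ys ++ drop d rest.
have Uxy : uniq (xs ++ ys).
  rewrite cat_uniq !map_inj_in_uniq ?enum_uniq //=; last 2 first.
  - by move=> i j; rewrite !mem_enum; apply: injy.
  - by move=> i j; rewrite !mem_enum; apply: injx.
  rewrite andbT; apply/hasPn => _ /mapP [j jA ->]; apply/mapP => -[i iA E].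
  by move: jA iA; rewrite !mem_enum => jA iA; move: (xy i j iA jA); rewrite E eqxx.
have size_xs : size xs = #|A| by rewrite size_map -cardE.
have size_ys : size ys = #|A| by rewrite size_map -cardE.
have size_rest : 2 * k - 2 * #|A| <= size rest.
  rewrite -cardE leq_subLR (leq_trans cardG) // -(cardC (mem (xs ++ ys))).
  by rewrite leq_add2r (card_uniqP Uxy) size_cat size_xs size_ys mul2n addnn.
have size_rest_d : d + d <= size rest.
  by apply: leq_trans size_rest; rewrite -mulnBr mul2n addnn.
have UXY : uniq (X ++ Y).
  have E : perm_eq (X ++ Y) ((xs ++ ys) ++ rest).
    by rewrite -[in X in perm_eq _ X](cat_take_drop d rest) -!catA perm_cat2l
      perm_catCA.
  rewrite (perm_uniq E) cat_uniq Uxy enum_uniq /= andbT.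
  by apply/hasPn => v; rewrite mem_enum.
have size_X : size X = k.
  rewrite size_cat size_xs size_takel ?subnKC //.
  by apply: leq_trans size_rest_d; apply: leq_addr.
have size_Y : k <= size Y.
  rewrite size_cat size_ys size_drop -leq_subLR -/d.
  by rewrite leq_subRL // (leq_trans _ size_rest_d) // leq_addr.
move: (UXY); rewrite cat_uniq => /and3P [UX /hasPn dXY UY].
pose g0 := x i0.
have ltX (i : 'I_k) : i < size X by rewrite size_X.
have ltY (i : 'I_k) : i < size Y by apply: leq_trans size_Y.
case: (pairG (fun i => nth g0 X i) (fun i => nth g0 Y i)).
- by move=> i j /eqP; rewrite nth_uniq // => /eqP /val_inj.
- by move=> i j /eqP; rewrite nth_uniq // => /eqP /val_inj.
- move=> i j; apply: contraNneq (dXY _ (mem_nth g0 (ltY j))) => <-.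
  exact: mem_nth.
move=> P [Pj Pd].
have idx i : i \in A -> index i (enum A) < #|A|.
  by move=> iA; rewrite cardE index_mem mem_enum.
have ltk i : i \in A -> index i (enum A) < k.
  by move/idx => lti; apply: leq_trans leAk.
have nthX i : i \in A -> nth g0 X (index i (enum A)) = x i.
  move=> iA; rewrite nth_cat size_xs idx // (nth_map i0) -?cardE ?idx //.
  by rewrite nth_index ?mem_enum.
have nthY i : i \in A -> nth g0 Y (index i (enum A)) = y i.
  move=> iA; rewrite nth_cat size_ys idx // (nth_map i0) -?cardE ?idx //.
  by rewrite nth_index ?mem_enum.
(* Demand [i] sits at position [index i (enum A)] of the padded lists; for [i]
   in [A] this is below [k], so the empty default never occurs there. *)
pose path_of i := if insub (index i (enum A)) is Some j
  then path_edges (nth g0 X (j : 'I_k)) (P j) else [::].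
exists (fun u v => [pick i in A | [set u; v] \in path_of i]); split.
  by move=> u v; rewrite setUC.
move=> i iA.
pose j : 'I_k := Ordinal (ltk i iA).
have path_ofi : path_of i = path_edges (x i) (P j).
  by rewrite /path_of (insubT (fun m => m < k) (ltk i iA)) /= nthX.
have owni u v : [set u; v] \in path_of i ->
    [pick l in A | [set u; v] \in path_of l] == Some i.
  move=> uv; case: pickP => [l /andP [lA ul]|/(_ i)]; last by rewrite iA uv.
  apply/eqP; congr Some; apply: contraTeq ul => li.
  rewrite /path_of (insubT (fun m => m < k) (ltk l lA)) /=.
  have /Pd : Ordinal (ltk i iA) != Ordinal (ltk l lA).
    apply: contraNneq li => -[] E.
    by rewrite -(nth_index i0 (s := enum A) (x := l)) ?mem_enum // -E
      nth_index ?mem_enum.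
  move/disjointFr => -> //=.
  by rewrite nthX // -path_ofi.
have := Pj j; rewrite /= nthX // nthY //.
case/and3P => + /eqP <- _; move: owni; rewrite path_ofi.
elim: (P j) (x i) => [|v p IHp] u //= owni /andP [uv vp].
apply: connect_trans (IHp v _ vp); last first.
  by move=> w w' ww'; apply: owni; rewrite inE ww' orbT.
by apply: connect1; rewrite /owned_by uv owni // mem_head.
Qed.

Lemma path_pairable_connected k (G : sgraph) (u v : G) :
  0 < k -> path_pairable k G -> connect (@adj G) u v.
Proof.
move=> k_gt0 pairG; case: (eqVneq u v) => [->|uv]; first exact: connect0.
have [||||own [_ link]] :=
    @path_pairable_routable k G unit setT (fun=> u) (fun=> v) pairG.
- by rewrite cardsT card_unit.
- by case=> [] [].
- by case=> [] [].
- by [].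
have := link tt (in_setT _); apply: (@connect_homo _ _ _ _ id).
by move=> w w' /andP [].
Qed.

(** * Relocating the terminals *)

Lemma ex_fresh_inj (T I V : finType) (f : T -> V) :
  #|T| + #|I| <= #|V| ->
  exists g : I -> V, injective g /\ forall i t, g i != f t.
Proof.
move=> le; pose C := ~: [set f t | t in T].
have leIC : #|I| <= #|C|.
  rewrite -(leq_add2l #|T|) (leq_trans le) // -(cardsC [set f t | t in T]).
  by rewrite leq_add2r leq_imset_card.
exists (fun i => enum_val (widen_ord leIC (enum_rank i))); split.
  by move=> i j /enum_val_inj [] /val_inj /enum_rank_inj.
move=> i t; have := enum_valP (widen_ord leIC (enum_rank i)).
by rewrite in_setC; apply: contraNneq => ->; apply: imset_f.
Qed.

(** Markov's inequality for the fibres of [f]. *)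
Lemma card_large_fibres (T V : finType) (f : T -> V) a b :
  #|T| < a.+1 * b.+1 -> #|[set v | b < #|[set t | f t == v]|]| <= a.
Proof.
move=> lt; rewrite -ltnS -(ltn_pmul2r (ltn0Sn b)); apply: leq_ltn_trans lt.
rewrite -sum_nat_const -[#|T|]sum1_card (partition_big f predT) //=.
rewrite [leqRHS](bigID [pred v | b < #|[set t | f t == v]|]) /=.
apply: leq_trans (leq_addr _ _).
rewrite (eq_bigl (fun v => b < #|[set t | f t == v]|)); last first.
  by move=> v; rewrite inE.
apply: leq_sum => v; rewrite sum1_card.
by congr (_ <= _); apply: eq_card => t; rewrite !inE.
Qed.

Section Relocation.

Variables (T U V : finType) (b : nat) (pos : T -> U * V) (nu : T -> U).
Hypotheses (b_gt0 : 0 < b) (pos_inj : injective pos).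
Hypotheses (nu_inj : injective nu) (nu_fresh : forall t t', nu t != (pos t').1).

Definition overloaded u := b < #|[set t | (pos t).1 == u]|.

Definition new_column t :=
  if overloaded (pos t).1 then nu t else (pos t).1.

Lemma new_position_inj : injective (fun t => (new_column t, (pos t).2)).
Proof.
move=> t t' [] + E2; rewrite /new_column.
case: ifP => _; case: ifP => _ E1.
- exact: nu_inj.
- by have := nu_fresh t t'; rewrite E1 eqxx.
- by have := nu_fresh t' t; rewrite E1 eqxx.
- by apply: pos_inj; move: E1 E2; case: (pos t); case: (pos t') => ? ? ? ? /= -> ->.
Qed.

(** A private column carries a single terminal, which is at most [b]; any other
    column still in use kept its original load and was not overloaded. *)
Lemma card_column_load u : #|[set t | new_column t == u]| <= b.
Proof.
case: (set_0Vmem [set t | new_column t == u]) => [->|[t0]].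
  by rewrite cards0.
rewrite inE => /eqP <-; rewrite {2}/new_column; case: ifPn => light0.
  rewrite (leq_trans _ b_gt0) // -(cards1 t0); apply/subset_leq_card/subsetP.
  move=> t; rewrite !inE /new_column; case: ifP => _; first by move/eqP/nu_inj->.
  by rewrite eq_sym (negbTE (nu_fresh _ _)).
move: (light0); rewrite -leqNgt; apply: leq_trans.
apply/subset_leq_card/subsetP => t; rewrite !inE /new_column.
by case: ifP => // _; rewrite (negbTE (nu_fresh _ _)).
Qed.

End Relocation.

(** * Combining rows and columns *)

Theorem theorem2 (a b s : nat) (G H : sgraph)
  (a_gt0 : 0 < a) (b_gt0 : 0 < b) (s_gt0 : 0 < s)
  (s_lt : 2 * s < (a + 1) * (b + 1))
  (pairG : path_pairable a G) (pairH : path_pairable b H)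
  (cardG : 4 * s <= #|G|) (cardH : 4 * s <= #|H|) :
  path_pairable s (cartesian G H).
Proof.
split.
  rewrite card_prod (leq_trans _ (leq_mul cardG cardH)) // leq_mul //.
    by rewrite (leq_trans _ (leq_mul (leqnn 4) s_gt0)).
  by rewrite leq_pmull.
move=> x y injx injy xy; apply: routable_paths.
(* A terminal is a pair index together with a side: [true] for [x]. *)
pose T : finType := ('I_s * bool)%type.
have cardT : #|T| = 2 * s by rewrite card_prod card_ord card_bool mulnC.
pose pos (t : T) : G * H := if t.2 then x t.1 else y t.1.
have pos_inj : injective pos.
  move=> [i []] [j []]; rewrite /pos /= => E.
  - by rewrite (injx _ _ E).
  - by have := xy i j; rewrite E eqxx.
  - by have := xy j i; rewrite E eqxx.
  - by rewrite (injy _ _ E).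
have [|nu [nu_inj nu_fresh]] := @ex_fresh_inj T T G (fun t => (pos t).1).
  by rewrite cardT -mulnDl.
have [|tau [tau_inj tau_fresh]] := @ex_fresh_inj T 'I_s H (fun t => (pos t).2).
  by rewrite cardT card_ord (leq_trans _ cardH) // -mulSnr leq_mul2r orbT.
pose heavy := overloaded b pos; pose col := new_column b pos nu.
have col_inj : injective (fun t => (col t, (pos t).2)) :=
  new_position_inj pos_inj nu_inj nu_fresh.
have row_routes h : routable [set t | (pos t).2 == h & heavy (pos t).1]
    (fun t => (pos t).1) nu.
  have inj_in : {in [set t | (pos t).2 == h & heavy (pos t).1] &,
      injective (fun t => (pos t).1)}.
    move=> t t'; rewrite !inE => /andP [/eqP E2 _] /andP [/eqP E2' _] E1.
    by apply: pos_inj; rewrite (surjective_pairing (pos t)) E1 E2 -E2'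
      -surjective_pairing.
  apply: (path_pairable_routable pairG _ inj_in).
  - (* Within a row, distinct terminals lie in distinct overloaded columns. *)
    rewrite -(card_in_imset inj_in).
    apply: leq_trans (@card_large_fibres T G (fun t => (pos t).1) a b _).
      apply/subset_leq_card/subsetP => _ /imsetP [t + ->].
      by rewrite !inE => /andP [].
    by rewrite cardT -(addn1 a) -(addn1 b).
  - by move=> t t' _ _; apply: nu_inj.
  - by move=> t t' _ _; rewrite eq_sym.
pose met (i : 'I_s) := col (i, true) == col (i, false).
(* When the two terminals of a pair share a column, the demand of the first one
   reaches the second, which then makes no demand of its own. *)
pose goal (t : T) := if met t.1 then (pos (t.1, false)).2 else tau t.1.
have col_routes c : routable [set t | col t == c & t.2 || ~~ met t.1]
    (fun t => (pos t).2) goal.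
  apply: (path_pairable_routable pairH).
  - apply: leq_trans (card_column_load b_gt0 nu_inj nu_fresh c).
    by apply/subset_leq_card/subsetP => t; rewrite !inE => /andP [].
  - move=> t t'; rewrite !inE => /andP [/eqP E _] /andP [/eqP E' _] E2.
    by apply: col_inj; rewrite /= E2 E -E'.
  - move=> [i r] [j r']; rewrite !inE /= /goal /= => /andP [/eqP ci di].
    move=> /andP [/eqP cj dj].
    case: ifP di => mi /= di; case: ifP dj => mj /= dj E.
    + move: di dj ci cj; rewrite !orbF => -> -> ci cj.
      suff: (i, false) = (j, false) by case=> ->.
      apply: col_inj; rewrite /= E.
      by rewrite -(eqP mi) -(eqP mj) ci cj.
    + by have := tau_fresh j (i, false); rewrite -E eqxx.
    + by have := tau_fresh i (j, false); rewrite E eqxx.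
    + have E' := tau_inj _ _ E; move: mi ci cj; rewrite E' /met.
      by case: (r); case: (r') => // /eqP + E1 E2; rewrite E1 E2.
  - move=> t [j r']; rewrite !inE /goal /= => /andP [/eqP ct dt].
    move=> /andP [/eqP cj dj]; case: ifP dj => mj dj; last by rewrite eq_sym.
    apply: contraTneq dt => E.
    suff -> : t = (j, false) by rewrite /= mj.
    apply: col_inj; rewrite /= E ct -cj -(eqP mj).
    by move: dj; rewrite orbF => ->.
have [ownR /all_and2 [ownRC linkR]] := fin_all_exists row_routes.
have [ownC /all_and2 [ownCC linkC]] := fin_all_exists col_routes.
(* The row [tau i] belongs entirely to the pair [i]; in the other rows and in the
   columns, an edge used for a terminal belongs to the pair of that terminal. *)
pose own (p q : cartesian G H) : option 'I_s :=
  if p.2 == q.2 then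
    if [pick i | tau i == p.2] is Some i then Some i
    else omap fst (ownR p.2 p.1 q.1)
  else if p.1 == q.1 then omap fst (ownC p.1 p.2 q.2) else None.
have ownS p q : own p q = own q p.
  rewrite /own [q.2 == _]eq_sym [q.1 == _]eq_sym.
  by case: eqP => [->|_]; rewrite 1?ownRC //; case: eqP => // ->; rewrite ownCC.
exists own; split=> // i _.
pose linked := connect (@owned_by (cartesian G H) _ own i).
have linked_sym : connect_sym (@owned_by (cartesian G H) _ own i).
  by apply: sym_connect_sym => p q; rewrite /owned_by adj_sym ownS.
have tau_row u v : linked (u, tau i) (v, tau i).
  have := path_pairable_connected u v a_gt0 pairG.
  apply: (connect_homo (f := pair^~ (tau i))).
  move=> {}u {}v uv.
  rewrite /owned_by /own /= /cart_adj /= uv eqxx orbT /=.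
  by case: pickP => [j /eqP /tau_inj ->|/(_ i)]; rewrite eqxx.
have to_new_column t : t.1 = i -> linked (pos t) (col t, (pos t).2).
  move=> ti; rewrite [X in linked X _]surjective_pairing /col /new_column.
  rewrite -/(heavy _); case: ifPn => ht; last exact: connect0.
  have := linkR (pos t).2 t; rewrite inE eqxx ht => /(_ isT).
  apply: (connect_homo (f := pair^~ (pos t).2)) => u v.
  case/andP => uv /eqP E.
  rewrite /owned_by /own /= /cart_adj /= uv eqxx orbT /=.
  case: pickP => [j|_]; first by rewrite (negbTE (tau_fresh _ _)).
  by rewrite E /= ti.
have in_column t : t.1 = i -> t.2 || ~~ met i ->
    linked (col t, (pos t).2) (col t, goal t).
  move=> ti dt; have := linkC (col t) t; rewrite inE eqxx ti dt => /(_ isT).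
  apply: (connect_homo (f := pair (col t))) => u v /andP [uv /eqP E].
  have /negbTE uv_neq : u != v by apply: contraTneq uv => ->; rewrite adj_irr.
  by rewrite /owned_by /own /= /cart_adj /= uv uv_neq eqxx E /= ti.
have from_x := to_new_column (i, true) erefl.
have from_y := to_new_column (i, false) erefl.
have := in_column (i, true) erefl isT.
have := in_column (i, false) erefl; rewrite /goal /=.
case: ifP => mi => [_|/(_ isT) down] up; apply: connect_trans from_x _;
  apply: connect_trans up _; rewrite linked_sym; apply: connect_trans from_y _.
  by rewrite (eqP mi); apply: connect0.
exact: connect_trans down (tau_row _ _).
Qed.
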